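(* Let $K$ be a field and let $A$ and $B$ be Morita equivalent finitely generated $K$-algebras. Then $h_A=h_B$.
   Context: Algebras are associative unital $K$-algebras; modules are left modules. For an algebra $A$, the holonomic number of $A$ is $$h_A:=\inf\{\operatorname{GK}(M)\mid M\ne 0 \text{ is a finitely generated } A\text{-module}\}.$$ Here $\operatorname{GK}$ is the Gelfand-Kirillov dimension: if $A$ is generated by $a_1,\dots,a_s$, put $A_0:=K$, $A_1:=K+\sum_j Ka_j$, $A_i:=A_1^i$, and for $M=AM_0$ with $M_0$ a finite dimensional generating subspace put $M_i:=A_iM_0$; then $\operatorname{GK}(M)=\gamma(i\mapsto\dim_K M_i)$, where $\gamma(f)=\inf\{r\in\mathbb{R}\mid f(i)\le i^r\text{ for } i\gg 0\}$ (with $\inf\emptyset=\infty$). Morita equivalence of $K$-algebras $A$ and $B$ means that there is a Morita context $\begin{pmatrix} A & X\\ Y & B\end{pmatrix}$ of $K$-algebras with bimodules ${}_AX_B$, ${}_BY_A$ such that $XY=A$ and $YX=B$. *)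

(* Defs.v *)
From HB Require Import structures.
From mathcomp Require Import all_boot all_order all_algebra.
From mathcomp Require Import all_classical all_reals all_analysis.

Set Implicit Arguments.
Unset Strict Implicit.
Unset Printing Implicit Defensive.

Import Order.TTheory GRing.Theory Num.Theory.

Local Open Scope classical_set_scope.
Local Open Scope ring_scope.

Section RestrictionOfScalars.
Variables (K : fieldType) (A : algType K) (M : lmodType A).

Definition res_scalars : Type := M.

HB.instance Definition _ := GRing.Zmodule.on res_scalars.

Let scale (k : K) (m : res_scalars) : res_scalars := (k%:A : A) *: (m : M).

Let scaleA k l m : scale k (scale l m) = scale (k * l) m.
Proof. by rewrite /scale scalerA -scalerAl mul1r scalerA. Qed.

Let scale1 : left_id 1 scale.
Proof. by move=> m; rewrite /scale !scale1r. Qed.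

Let scaleDr : right_distributive scale +%R.
Proof. by move=> k m n; rewrite /scale scalerDr. Qed.

Let scaleDl m : {morph scale^~ m : k l / k + l}.
Proof. by move=> k l; rewrite /scale !scalerDl. Qed.

HB.instance Definition _ :=
  GRing.Zmodule_isLmodule.Build K res_scalars scaleA scale1 scaleDr scaleDl.

End RestrictionOfScalars.
Arguments res_scalars {K A} M.

(* M and res_scalars M are convertible but are modules over A and over K:    *)
(* V selects which of the two spans is meant.                                 *)
Definition lspan (S : pzRingType) (V : lmodType S) (X : set V) : set V :=
  [set v | exists n (c : 'I_n -> S) (x : 'I_n -> V),
     (forall i, X (x i)) /\ v = \sum_i c i *: x i].

Definition lin_indep (K : fieldType) (V : lmodType K) n (v : 'I_n -> V) :=
  forall c : 'I_n -> K, \sum_i c i *: v i = 0 -> forall i, c i = 0.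

(* Dimension of a (possibly infinite dimensional) subspace W. *)
Definition dimK (R : realType) (K : fieldType) (V : lmodType K) (W : set V) :
    \bar R :=
  ereal_sup [set d | exists n (v : 'I_n -> V),
    [/\ forall i, W (v i), lin_indep v & d = (n%:R)%:E]].

Definition growth (R : realType) (f : nat -> \bar R) : \bar R :=
  ereal_inf [set r%:E | r in
    [set r : R | \forall i \near \oo, (f i <= (i%:R `^ r)%:E)%E]].

Section Filtrations.
Variables (K : fieldType) (A : algType K).

Definition is_subalg (S : set A) :=
  [/\ S 1, forall x y, S x -> S y -> S (x + y),
      forall x y, S x -> S y -> S (x * y) &
      forall (k : K) x, S x -> S (k *: x)].

Definition alg_generators (a : seq A) :=
  forall S : set A, is_subalg S -> [set` a] `<=` S -> S = [set: A].

Definition alg_fin_gen := exists a : seq A, alg_generators a.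

Fixpoint alg_filt (a : seq A) (i : nat) : set A :=
  if i is j.+1 then
    lspan [set x | exists u v : A,
      [/\ lspan ([set 1] `|` [set` a]) u, alg_filt a j v & x = u * v]]
  else lspan [set 1].

Variable M : lmodType A.

Definition mod_fin_gen := exists m : seq M, lspan (V := M) [set` m] = [set: M].

Definition fin_dim_generating (M0 : set (res_scalars M)) :=
  (exists m : seq (res_scalars M), M0 = lspan (V := res_scalars M) [set` m]) /\
  lspan (V := M) M0 = [set: M].

Definition mod_filt (a : seq A) (M0 : set (res_scalars M)) (i : nat) :
    set (res_scalars M) :=
  lspan (V := res_scalars M) [set x | exists (u : A) (m : M),
    [/\ alg_filt a i u, M0 m & x = u *: m]].

Definition GK_at (R : realType) (a : seq A) (M0 : set (res_scalars M)) :
    \bar R :=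
  growth (fun i => dimK R (V := res_scalars M) (mod_filt a M0 i)).

(* By GKE below, the value does not depend on the chosen generators. *)
Definition GK (R : realType) : \bar R :=
  xget +oo%E [set d | exists a M0,
    [/\ alg_generators a, fin_dim_generating M0 & d = GK_at R a M0]].

End Filtrations.
Arguments alg_fin_gen {K} A.
Arguments mod_fin_gen {K A} M.

Section SpanTheory.
Variables (S : pzRingType) (V : lmodType S).
Implicit Types (X W : set V).

Definition is_submod W :=
  [/\ W 0, forall x y, W x -> W y -> W (x + y) &
      forall c x, W x -> W (c *: x)].

Lemma sub_lspan X : X `<=` lspan X.
Proof.
move=> x Xx; exists 1%N, (fun=> 1), (fun=> x); split => //.
by rewrite big_ord1 scale1r.
Qed.

Lemma lspan_submod X : is_submod (lspan X).
Proof.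
split.
- by exists 0%N, (fun=> 0), (fun=> 0); split; [case | rewrite big_ord0].
- move=> _ _ [m [c [x [Xx ->]]]] [n [d [y [Xy ->]]]].
  exists (m + n)%N.
  exists (fun i => match fintype.split i with inl j => c j | inr j => d j end).
  exists (fun i => match fintype.split i with inl j => x j | inr j => y j end).
  split; first by move=> i; case: (fintype.split i).
  rewrite big_split_ord; congr (_ + _); apply: eq_bigr => i _.
    by rewrite (unsplitK (inl i)).
  by rewrite (unsplitK (inr i)).
- move=> c _ [m [d [x [Xx ->]]]]; exists m, (fun i => c * d i), x; split => //.
  by rewrite scaler_sumr; apply: eq_bigr => i _; rewrite scalerA.
Qed.

Lemma lspan_min X W : is_submod W -> X `<=` W -> lspan X `<=` W.
Proof.
move=> [W0 WD WZ] XW _ [m [c [x [Xx ->]]]].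
by apply: big_ind => // i _; apply: WZ; apply: XW.
Qed.

End SpanTheory.

Lemma directed_seq (T : eqType) (F : nat -> set T) (s : seq T) :
  (forall i j, (i <= j)%N -> F i `<=` F j) -> (forall x, exists i, F i x) ->
  exists i, [set` s] `<=` F i.
Proof.
move=> Fmono Fall; elim: s => [|x s [i IH]]; first by exists 0%N.
have [j Fjx] := Fall x; exists (i + j)%N => y /=.
rewrite inE => /orP[/eqP ->|ys]; first exact: (Fmono _ _ (leq_addl _ _)).
by apply: (Fmono _ _ (leq_addr _ _)); apply: IH.
Qed.

Section FiltrationTheory.
Variables (K : fieldType) (A : algType K).
Implicit Type a : seq A.


Lemma alg_filt_submod a i : is_submod (alg_filt a i).
Proof. by case: i => [|i]; apply: lspan_submod. Qed.

Lemma alg_filt_mono a i j : (i <= j)%N -> alg_filt a i `<=` alg_filt a j.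
Proof.
elim: j => [|j IH]; first by rewrite leqn0 => /eqP ->.
rewrite leq_eqVlt => /orP[/eqP -> //|]; rewrite ltnS => /IH ij x /ij ax.
apply: sub_lspan; exists 1, x; split => //; last by rewrite mul1r.
by apply: sub_lspan; left.
Qed.

Lemma alg_filtM a i j u v :
  alg_filt a i u -> alg_filt a j v -> alg_filt a (i + j) (u * v).
Proof.
elim: i u => [|i IH] u au av.
  have [W0 WD WZ] := alg_filt_submod a j.
  suff : lspan [set 1] `<=` [set w | alg_filt a j (w * v)] by apply.
  apply: lspan_min => [|_ -> /=]; last by rewrite mul1r.
  split => /= [|x y|k x]; first by rewrite mul0r.
    by rewrite mulrDl; exact: WD.
  by rewrite -scalerAl; exact: WZ.
have [W0 WD WZ] := alg_filt_submod a (i.+1 + j).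
suff : alg_filt a i.+1 `<=` [set w | alg_filt a (i.+1 + j) (w * v)] by apply.
apply: lspan_min => [|_ [x [y [ax ay ->]]] /=].
  split => /= [|x y|k x]; first by rewrite mul0r.
    by rewrite mulrDl; exact: WD.
  by rewrite -scalerAl; exact: WZ.
by rewrite -mulrA; apply: sub_lspan; exists x, (y * v); split => //; exact: IH.
Qed.

Lemma alg_filt_all a : alg_generators a -> forall x, exists i, alg_filt a i x.
Proof.
move=> ga x; suff : [set y | exists i, alg_filt a i y] x by [].
rewrite (ga [set y | exists i, alg_filt a i y]) //.
  split => /= [|y z [i yi] [j zj]|y z [i yi] [j zj]|k y [i yi]].
  - by exists 0%N; apply: sub_lspan.
  - exists (i + j)%N; have [_ WD _] := alg_filt_submod a (i + j).
    by apply: WD; [move: yi|move: zj]; apply: alg_filt_mono;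
      rewrite ?leq_addr ?leq_addl.
  - by exists (i + j)%N; exact: alg_filtM.
  - by exists i; have [_ _ WZ] := alg_filt_submod a i; exact: WZ.
move=> y ay; exists 1%N; apply: sub_lspan; exists y, 1; split.
- by apply: sub_lspan; right.
- by apply: sub_lspan.
- by rewrite mulr1.
Qed.

Lemma alg_filt_compare (a : seq A) a' : alg_generators a ->
  exists p, forall i, alg_filt a' i `<=` alg_filt a (p * i).
Proof.
move=> ga.
have [p pa'] := directed_seq (1 :: a') (@alg_filt_mono a) (alg_filt_all ga).
exists p; elim=> [|i IH]; first by rewrite muln0.
apply: lspan_min; first exact: alg_filt_submod.
move=> _ [u [v [au av ->]]]; rewrite mulnS; apply: alg_filtM; last exact: IH.
move: u au; apply: lspan_min; first exact: alg_filt_submod.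
by move=> u [->|au]; apply: pa'; rewrite /= inE ?eqxx // au orbT.
Qed.

Variable M : lmodType A.

Lemma mod_filt_submod a (M0 : set (res_scalars M)) i :
  is_submod (V := res_scalars M) (mod_filt a M0 i).
Proof. exact: lspan_submod. Qed.

Lemma mod_filt_min a (M0 : set (res_scalars M)) i (W : set (res_scalars M)) :
  is_submod (V := res_scalars M) W ->
  (forall (u : A) (m : M), alg_filt a i u -> M0 m -> W (u *: m)) ->
  mod_filt a M0 i `<=` W.
Proof.
move=> subW sub; apply: lspan_min => // _ [u [m [au Mm ->]]]; exact: sub.
Qed.

Lemma mod_filtM a (M0 : set (res_scalars M)) i j (u : A) (x : M) :
  alg_filt a i u -> mod_filt a M0 j x -> mod_filt a M0 (i + j) (u *: x).
Proof.
move=> au; move: x.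
have [W0 WD WZ] := mod_filt_submod a M0 (i + j).
apply: mod_filt_min => [|w m aw Mm /=].
  split => /= [|x y|k x]; first by rewrite scaler0.
    by rewrite scalerDr; exact: WD.
  move=> /(WZ k) H.
  have -> : u *: (k *: x : M) = k *: (u *: (x : M) : res_scalars M) :> M.
    rewrite [k *: x]/GRing.scale [k *: (_ : res_scalars M)]/GRing.scale /=.
    by rewrite !scalerA -scalerAl -scalerAr mul1r mulr1.
  exact: H.
rewrite scalerA; apply: sub_lspan; exists (u * w), m; split => //.
exact: alg_filtM.
Qed.

Lemma mod_filt_mono a (M0 : set (res_scalars M)) i j :
  (i <= j)%N -> mod_filt a M0 i `<=` mod_filt a M0 j.
Proof.
move=> ij; apply: mod_filt_min; first exact: mod_filt_submod.
move=> u m au Mm; apply: sub_lspan; exists u, m; split => //.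
exact: alg_filt_mono au.
Qed.

Lemma mod_filt_all a (M0 : set (res_scalars M)) : alg_generators a -> fin_dim_generating M0 ->
  forall x : res_scalars M, exists i, mod_filt a M0 i x.
Proof.
move=> ga [_ gM] x.
have : lspan (V := M) M0 `<=` [set y | exists i, mod_filt a M0 i y].
  apply: lspan_min => [|y My].
    split => /= [|y z [i yi] [j zj]|c y [j yj]].
    - by exists 0%N; case: (mod_filt_submod a M0 0).
    - exists (i + j)%N; have [_ WD _] := mod_filt_submod a M0 (i + j).
      by apply: WD; [move: yi|move: zj]; apply: mod_filt_mono;
        rewrite ?leq_addr ?leq_addl.
    - have [i ci] := alg_filt_all ga c.
      by exists (i + j)%N; exact: mod_filtM.
  exists 0%N; apply: sub_lspan; exists 1, y; split => //; last by rewrite scale1r.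
  exact: sub_lspan.
by rewrite gM; apply.
Qed.

Lemma mod_filt_compare (a a' : seq A) (M0 M0' : set (res_scalars M)) :
  alg_generators a -> fin_dim_generating M0 -> fin_dim_generating M0' ->
  exists p q, forall i, mod_filt a' M0' i `<=` mod_filt a M0 (p * i + q).
Proof.
move=> ga gM [[m' M0'E] _]; have [p paa'] := alg_filt_compare a' ga.
have [q qm'] := directed_seq m' (@mod_filt_mono a M0) (mod_filt_all ga gM).
exists p, q => i; apply: mod_filt_min; first exact: mod_filt_submod.
move=> u m au Mm; apply: mod_filtM; first exact: paa'.
move: m Mm; rewrite M0'E.
by apply: (@lspan_min _ (res_scalars M)); first exact: mod_filt_submod.
Qed.

End FiltrationTheory.

Section GrowthTheory.
Variable R : realType.

Lemma le_dimK (K : fieldType) (V : lmodType K) (W W' : set V) :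
  W `<=` W' -> (dimK R W <= dimK R W')%E.
Proof.
move=> WW'; apply: ereal_sup_le => _ [n [v [Wv li ->]]].
by exists n, v; split => // i; apply: WW'.
Qed.

Lemma le_growth (f g : nat -> \bar R) p q :
  (forall i, (f i <= g (p.+1 * i + q)%N)%E) -> (growth f <= growth g)%E.
Proof.
move=> fg; apply: le_ereal_inf_tmp => _ [r [N _ gN] <-].
have fr i : (N <= i)%N -> (f i <= ((p.+1 * i + q)%:R `^ r)%:E)%E.
  move=> Ni; apply: (le_trans (fg i)); apply: gN => /=.
  by rewrite (leq_trans Ni)// mulSn -addnA leq_addr.
have [r0|r0] := ltP r 0.
  apply: ge_ereal_inf; exists r%:E => //; exists r => //.
  exists N.+1 => // i /= Ni; apply: (le_trans (fr _ (ltnW Ni))).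
  have i0 : (0 < i)%N by apply: leq_trans Ni.
  have ipq : (i <= p.+1 * i + q)%N by rewrite mulSn -addnA leq_addr.
  rewrite lee_fin -[r]opprK !(powRN _ (- r)) lef_pV2 ?posrE ?powR_gt0 ?ltr0n//.
    by apply: ge0_ler_powR; rewrite ?nnegrE ?ler0n ?ler_nat// oppr_ge0 ltW.
  exact: leq_trans ipq.
apply/lee_addgt0Pr => e e0.
apply: ge_ereal_inf; exists (r + e)%:E => //; exists (r + e) => //.
pose c : R := (p.+1 + q)%:R `^ r.
near=> i.
have i1 : (0 < i)%N by near: i; exact: nbhs_infty_gt.
have Ni : (N <= i)%N by near: i; exact: nbhs_infty_ge.
apply: (le_trans (fr _ Ni)); rewrite lee_fin.
have -> : i%:R `^ (r + e) = i%:R `^ r * i%:R `^ e :> R.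
  by rewrite powRD// pnatr_eq0 -lt0n i1 implybT.
apply: (@le_trans _ _ (i%:R `^ r * c)).
  rewrite -powRM ?ler0n// -natrM; apply: ge0_ler_powR => //.
  - by rewrite nnegrE ler0n.
  - by rewrite nnegrE ler0n.
  - by rewrite ler_nat mulnDr (mulnC i) leq_add2l leq_pmull.
rewrite ler_wpM2l ?powR_ge0//.
have -> : c = (c `^ e^-1) `^ e.
  by rewrite -powRrM mulVf ?gt_eqF// powRr1 ?powR_ge0.
apply: ge0_ler_powR; rewrite ?nnegrE ?powR_ge0 ?ler0n ?ltW//.
by near: i; exact: nbhs_infty_gtr.
Unshelve. all: by end_near.
Qed.

End GrowthTheory.

Lemma GK_at_le (R : realType) (K : fieldType) (A : algType K) (M : lmodType A)
    (a a' : seq A) (M0 M0' : set (res_scalars M)) :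
  alg_generators a -> fin_dim_generating M0 -> fin_dim_generating M0' ->
  (GK_at R a' M0' <= GK_at R a M0)%E.
Proof.
move=> ga gM gM'; have [p [q cmp]] := mod_filt_compare a' ga gM gM'.
apply: (@le_growth _ _ _ p q) => i; apply: le_dimK => x /cmp.
by apply: mod_filt_mono; rewrite leq_add2r leq_mul2r leqnSn orbT.
Qed.

Theorem GKE (R : realType) (K : fieldType) (A : algType K) (M : lmodType A)
    (a : seq A) (M0 : set (res_scalars M)) :
  alg_generators a -> fin_dim_generating M0 -> GK M R = GK_at R a M0.
Proof.
move=> ga gM; apply: xget_unique; first by exists a, M0.
move=> _ [a' [M0' [ga' gM' ->]]]; apply/eqP; rewrite eq_le.
by apply/andP; split; apply: GK_at_le.
Qed.

Definition holonomic_number (R : realType) (K : fieldType) (A : algType K) :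
    \bar R :=
  ereal_inf [set d | exists M : lmodType A,
    [/\ exists x : M, x != 0, mod_fin_gen M & d = GK M R]].

(* K acts centrally: both actions are K-bilinear for the same K-structure. *)
Record bimodule (K : fieldType) (A B : algType K) := Bimodule {
  bimod_sort :> lmodType K;
  lact : {bilinear A -> bimod_sort -> bimod_sort};
  ract : {bilinear bimod_sort -> B -> bimod_sort};
  lact1 : forall x, lact 1 x = x;
  ract1 : forall x, ract x 1 = x;
  lactA : forall (a a' : A) x, lact (a * a') x = lact a (lact a' x);
  ractA : forall x (b b' : B), ract x (b * b') = ract (ract x b) b';
  lractA : forall a x b, ract (lact a x) b = lact a (ract x b)
}.

Arguments lact {K A B _}.
Arguments ract {K A B _}.

(* The laws are the associativity of the product of the matrices (A X; Y B).  *)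
Record morita_context (K : fieldType) (A B : algType K) := MoritaContext {
  ctxX : bimodule A B;
  ctxY : bimodule B A;
  mulXY : {bilinear ctxX -> ctxY -> A};
  mulYX : {bilinear ctxY -> ctxX -> B};
  mulAXY : forall a x y, mulXY (lact a x) y = a * mulXY x y;
  mulXBY : forall x b y, mulXY (ract x b) y = mulXY x (lact b y);
  mulXYA : forall x y a, mulXY x (ract y a) = mulXY x y * a;
  mulBYX : forall b y x, mulYX (lact b y) x = b * mulYX y x;
  mulYAX : forall y a x, mulYX (ract y a) x = mulYX y (lact a x);
  mulYXB : forall y x b, mulYX y (ract x b) = mulYX y x * b;
  mulXYX : forall x y x', lact (mulXY x y) x' = ract x (mulYX y x');
  mulYXY : forall y x y', lact (mulYX y x) y' = ract y (mulXY x y')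
}.

Arguments mulXY {K A B _}.
Arguments mulYX {K A B _}.

Definition morita_equivalent (K : fieldType) (A B : algType K) :=
  exists C : morita_context A B,
    lspan [set a | exists x y, a = mulXY (m := C) x y] = [set: A] /\
    lspan [set b | exists y x, b = mulYX (m := C) y x] = [set: B].

(* Main.v *)
(* By symmetry it suffices to bound h_B by h_A. Write 1_B = sum_k y_k x_k. *)
(* Then b |-> (x_k b y_l)_kl is a (non-unital) ring morphism p from B to *)
(* n x n matrices over A, and for an A-module M the B-module Y (x)_A M is *)
(* realised as N = {m in M^n | p(1) m = m}. It is nonzero and finitely *)
(* generated when M is. The entries of p(b) for the generators b of B lie in *)
(* one A_r, so the coordinates of N_i lie in M_(r i + q); hence *)
(* dim N_i <= n dim M_(r i + q) and GK(N) <= GK(M). *)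
From HB Require Import structures.
Require Import Defs.
From mathcomp Require Import all_boot all_order all_algebra.
From mathcomp Require Import all_classical all_reals all_analysis.

Set Implicit Arguments.
Unset Strict Implicit.
Unset Printing Implicit Defensive.

Import Order.TTheory GRing.Theory Num.Theory.

Local Open Scope classical_set_scope.
Local Open Scope ring_scope.

(** Passing from M to Y (x)_A M cannot raise the Gelfand-Kirillov dimension, and Morita equivalence
    makes this possible in both directions. The corner module N of [corner_module] embeds in M^n by
    coordinates on which B acts through matrices over A, so filtering N by B costs only a linear
    change of index in the filtration of M, plus a constant factor for the n coordinates; growth
    ignores both ([GK_le_corner]). The equation 1_B = sum_k y_k x_k makes these matrices
    multiplicative ([mulXY_insert]). The equation 1_A = sum_i x'_i y'_i makes N nonzero
    ([ctx_tensor_eq0]) and finitely generated ([corner_fin_gen]). *)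

(** * Dimension under jointly injective linear maps *)

Lemma max_lin_indep_span (K : fieldType) (V : lmodType K) (W : set V) t
    (v : 'I_t -> V) :
  (forall i, W (v i)) -> lin_indep v ->
  (forall u : 'I_t.+1 -> V, (forall i, W (u i)) -> ~ lin_indep u) ->
  forall w, W w -> exists c : 'I_t -> K, w = \sum_i c i *: v i.
Proof.
move=> Wv vfree vmax w Ww.
pose u (i : 'I_t.+1) := if unlift ord0 i is Some j then v j else w.
have Wu i : W (u i) by rewrite /u; case: (unlift ord0 i).
apply: contrapT => wN; apply: (vmax u Wu) => c.
rewrite big_ord_recl /u unlift_none.
under eq_bigr do rewrite liftK.
move=> cu.
have c0 : c ord0 = 0.
  apply/eqP; apply: contrapT => /negP c0; apply: wN.
  exists (fun i => - (c ord0)^-1 * c (lift ord0 i)).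
  under eq_bigr do rewrite -scalerA.
  rewrite -scaler_sumr; move/eqP: cu; rewrite addrC addr_eq0 => /eqP ->.
  by rewrite scalerN scaleNr opprK scalerA mulVf// scale1r.
move: cu; rewrite c0 scale0r add0r => /vfree cv i.
by case: (unliftP ord0 i) => [j ->|->].
Qed.

(** The coordinates of all the images of one vector form a vector of K^(n t), and joint injectivity
    makes this assignment injective on the span of [u]. *)
Lemma lin_indep_leq (K : fieldType) (V W : lmodType K) n s t
    (f : 'I_n -> V -> W) (u : 'I_s -> V) (v : 'I_t -> W) :
  (forall k, linear (f k)) -> (forall x, (forall k, f k x = 0) -> x = 0) ->
  lin_indep u ->
  (forall k i, exists c : 'I_t -> K, f k (u i) = \sum_j c j *: v j) ->
  (s <= n * t)%N.
Proof.
move=> flin finj ufree fu.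
have /choice[c cE] : forall k, exists c : 'I_s -> 'I_t -> K,
    forall i, f k (u i) = \sum_j c i j *: v j.
  by move=> k; have [c cE] := choice (fu k); exists c.
(* Row i lists the coordinates of every [f k (u i)]; a row vector killing [P] is a linear relation
   among the [u i]. *)
pose P := \matrix_i mxvec (\matrix_(k < n, j < t) c k i j).
suff /eqP <- : row_free P by exact: rank_leq_col.
rewrite -kermx_eq0; apply/rowV0P => d /sub_kermxP dP.
have dc k j : \sum_i d 0 i * c k i j = 0.
  transitivity ((d *m P) 0 (mxvec_index k j)); last by rewrite dP mxE.
  by rewrite mxE; apply: eq_bigr => i _; rewrite mxE mxvecE mxE.
have du : \sum_i d 0 i *: u i = 0.
  apply: finj => k.
  have fsum : f k (\sum_i d 0 i *: u i) = \sum_i d 0 i *: f k (u i).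
    pose fk := HB.pack_for {linear V -> W} (f k)
      (GRing.isLinear.Build K V W *:%R (f k) (flin k)).
    rewrite -[f k]/(fk : V -> W) linear_sum.
    by apply: eq_bigr => i _; rewrite linearZ.
  rewrite fsum; under eq_bigr do rewrite cE scaler_sumr.
  rewrite exchange_big big1// => j _.
  by under eq_bigr do rewrite scalerA; rewrite -scaler_suml dc scale0r.
by apply/rowP => i; rewrite mxE (ufree _ du).
Qed.

Lemma dimK_joint_inj (R : realType) (K : fieldType) (V W : lmodType K) n
    (f : 'I_n -> V -> W) (U : set V) (W0 : set W) :
  (forall k, linear (f k)) -> (forall x, (forall k, f k x = 0) -> x = 0) ->
  (forall k x, U x -> W0 (f k x)) ->
  (dimK R U <= n.+1%:R%:E * dimK R W0)%E.
Proof.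
move=> flin finj fU; apply: ge_ereal_sup => _ [s [u [Uu ufree ->]]].
(* The cap by [s] guarantees a maximum even when [W0] has infinite dimension. *)
pose Q t := `[< (t <= s)%N /\
  exists v : 'I_t -> W, (forall i, W0 (v i)) /\ lin_indep v >].
have Q0 : exists t, Q t.
  exists 0%N; apply/asboolP; split => //.
  by exists (fun=> 0); split; [case | move=> c _ []].
have Qs t : Q t -> (t <= s)%N by move=> /asboolP[].
have [t /asboolP[ts [v [Wv vfree]]] tmax] := ex_maxnP Q0 Qs.
(* If the cap is reached, a positive factor suffices, which [n.+1] provides even for n = 0.
   Otherwise [v] is maximal, so it spans [W0] and s <= n t. *)
have st : (s <= n.+1 * t)%N.
  have [->|nst] := eqVneq s t; first by rewrite leq_pmull.
  have {nst}ts : (t < s)%N by rewrite ltn_neqAle eq_sym nst.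
  apply: (@leq_trans (n * t)); last by rewrite leq_mul2r leqnSn orbT.
  apply: (lin_indep_leq flin finj ufree) => k i.
  apply: (max_lin_indep_span Wv vfree) (fU _ _ (Uu i)) => w Ww wfree.
  have /tmax : Q t.+1 by apply/asboolP; split => //; exists w.
  by rewrite ltnn.
apply: (@le_trans _ _ (n.+1%:R%:E * t%:R%:E)%E).
  by rewrite -EFinM lee_fin -natrM ler_nat.
apply: lee_wpmul2l; first by rewrite lee_fin.
by apply: ereal_sup_ubound; exists t, v.
Qed.

(** * Growth and constant factors *)

(** For every e > 0 the constant is at most i^e once i exceeds its e-th root, so the exponent rises
    by an arbitrarily small amount. *)
Lemma le_growth_muln (R : realType) (f : nat -> \bar R) c :
  (growth (fun i => c.+1%:R%:E * f i) <= growth f)%E.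
Proof.
apply: le_ereal_inf_tmp => _ [r [N _ fN] <-].
apply/lee_addgt0Pr => e e0.
apply: ge_ereal_inf; exists (r + e)%:E => //; exists (r + e) => //.
near=> i.
have i1 : (0 < i)%N by near: i; exact: nbhs_infty_gt.
have Ni : (N <= i)%N by near: i; exact: nbhs_infty_ge.
apply: (@le_trans _ _ (c.+1%:R%:E * (i%:R `^ r)%:E)%E).
  by apply: lee_wpmul2l; [rewrite lee_fin | exact: fN].
rewrite -EFinM lee_fin powRD; last by rewrite pnatr_eq0 -lt0n i1 implybT.
rewrite mulrC ler_wpM2l ?powR_ge0//.
have -> : c.+1%:R = (c.+1%:R `^ e^-1) `^ e :> R.
  by rewrite -powRrM mulVf ?gt_eqF// powRr1.
apply: ge0_ler_powR; rewrite ?nnegrE ?powR_ge0 ?ler0n ?ltW//.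
by near: i; exact: nbhs_infty_gtr.
Unshelve. all: by end_near.
Qed.

(** * Spans and finite generation *)

Lemma lspan_mono (S : pzRingType) (V : lmodType S) (X Y : set V) :
  X `<=` Y -> lspan X `<=` lspan Y.
Proof.
by move=> XY; apply: lspan_min (lspan_submod Y) _ => x /XY; exact: sub_lspan.
Qed.

Lemma submod_sum (S : pzRingType) (V : lmodType S) (W : set V) (I : Type)
    (r : seq I) (F : I -> V) :
  is_submod W -> (forall i, W (F i)) -> W (\sum_(i <- r) F i).
Proof. by move=> [W0 WD _] WF; apply: big_ind. Qed.

Lemma mod_fin_gen_fin_dim (K : fieldType) (A : algType K) (M : lmodType A) :
  mod_fin_gen M -> exists M0 : set (res_scalars M), fin_dim_generating M0.
Proof.
move=> [m mM]; exists (lspan (V := res_scalars M) [set` m]); split.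
  by exists m.
rewrite -subTset -mM; apply: lspan_mono.
exact: (@sub_lspan K (res_scalars M)).
Qed.

Lemma mod_filt_subset_fin (K : fieldType) (A : algType K) (M : lmodType A)
    (a : seq A) (M0 : set (res_scalars M)) (n : nat) (I : eqType) (s : seq I)
    (F : I -> 'I_n -> M) :
  alg_generators a -> fin_dim_generating M0 ->
  exists q, forall i k, i \in s -> mod_filt a M0 q (F i k).
Proof.
move=> ga gM; pose r : seq M := [seq F i k | i <- s, k <- enum 'I_n].
have [q qr] := directed_seq r (@mod_filt_mono K A M a M0)
  (mod_filt_all ga gM).
exists q => i k si; apply: qr => /=.
by apply: (allpairs_f F) => //; rewrite mem_enum.
Qed.

(** * The module cut out of M^n by a non-unital matrix representation *)

Section Corner.
Variables (A B : pzRingType) (M : lmodType A) (n : nat) (p : B -> 'M[A]_n).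

(* [p] need not be unital, so [mxact 1] is only an idempotent and [corner] is *)
(* its image. *)
Definition mxact b (m : 'I_n -> M) k : M := \sum_l p b k l *: m l.

Definition corner : {pred {ffun 'I_n -> M}} :=
  [pred m : {ffun 'I_n -> M} | [forall k, mxact 1 m k == m k]].

Lemma cornerP (m : {ffun 'I_n -> M}) :
  reflect (mxact 1 m =1 m) (m \in corner).
Proof. exact: eqfunP. Qed.

Lemma corner_zmod_closed : zmod_closed corner.
Proof.
split=> [|u v /cornerP uP /cornerP vP]; apply/cornerP => k.
  by rewrite /mxact big1 => [|l _]; rewrite ffunE// scaler0.
rewrite !ffunE -uP -vP /mxact -sumrB.
by apply: eq_bigr => l _; rewrite !ffunE scalerBr.
Qed.

HB.instance Definition _ :=
  GRing.isZmodClosed.Build {ffun 'I_n -> M} corner corner_zmod_closed.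

Definition corner_mod := {m | m \in corner}.
HB.instance Definition _ := SubType.on corner_mod.
HB.instance Definition _ := Choice.on corner_mod.
HB.instance Definition _ := [SubChoice_isSubZmodule of corner_mod by <:].

Hypotheses (pD : {morph p : b c / b + c})
           (pM : forall b c, p (b * c) = p b *m p c).

Lemma mxactM b c m : mxact b (mxact c m) =1 mxact (b * c) m.
Proof.
move=> k; rewrite /mxact pM.
under [RHS]eq_bigr do rewrite mxE scaler_suml.
under [LHS]eq_bigr do rewrite scaler_sumr.
rewrite exchange_big; apply: eq_bigr => l _; apply: eq_bigr => j _.
by rewrite scalerA.
Qed.

Lemma eq_mxact b m m' : m =1 m' -> mxact b m =1 mxact b m'.
Proof. by move=> mm' k; apply: eq_bigr => l _; rewrite mm'. Qed.

Lemma mxact_corner b (m : {ffun 'I_n -> M}) :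
  [ffun k => mxact b m k] \in corner.
Proof.
apply/cornerP => k; rewrite ffunE -[in RHS](mul1r b) -mxactM.
by apply: eq_mxact => l; rewrite ffunE.
Qed.

(** The idempotent [p 1] acts as the identity on its image, which restores the unit law. Later
    arguments use [N] only through its coordinate map [f]. *)
Lemma corner_module : exists (N : lmodType B) (f : N -> 'I_n -> M),
  [/\ forall u v, f u =1 f v -> u = v,
      forall u v k, f (u + v) k = f u k + f v k,
      forall b v, f (b *: v) =1 mxact b (f v) &
      forall m, mxact 1 m =1 m -> exists v, f v =1 m].
Proof.
pose sc b (v : corner_mod) : corner_mod :=
  exist _ [ffun k => mxact b (\val v) k] (mxact_corner b (\val v)).
have eqP (u v : corner_mod) : \val u =1 \val v -> u = v.
  by move=> uv; apply/val_inj/ffunP.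
have scA b c v : sc b (sc c v) = sc (b * c) v.
  apply: eqP => k; rewrite !ffunE -mxactM.
  by apply: eq_mxact => l; rewrite ffunE.
have sc1 : left_id 1 sc.
  by move=> v; apply: eqP => k; rewrite ffunE; exact: (cornerP _ (valP v)).
have scDr : right_distributive sc +%R.
  move=> b u v; apply: eqP => k; rewrite !ffunE /mxact -big_split.
  by apply: eq_bigr => l _; rewrite !ffunE scalerDr.
have scDl v : {morph sc^~ v : b c / b + c}.
  move=> b c; apply: eqP => k; rewrite !ffunE /mxact -big_split.
  by apply: eq_bigr => l _; rewrite pD mxE scalerDl.
pose N := HB.pack_for (lmodType B) corner_mod
  (GRing.Zmodule_isLmodule.Build B corner_mod scA sc1 scDr scDl).
exists N, (fun v : corner_mod => \val v : 'I_n -> M).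
split=> [|u v k|b v k|m m1]; [exact: eqP|by rewrite ffunE|by rewrite ffunE|].
have mP : [ffun k => m k] \in corner.
  apply/cornerP => k; rewrite ffunE -[RHS]m1.
  by apply: eq_mxact => l; rewrite ffunE.
pose v : corner_mod := exist _ [ffun k => m k] mP.
by exists v => k; rewrite ffunE.
Qed.

End Corner.

(** * Comparing Gelfand-Kirillov dimensions through coordinates *)

Lemma res_scalerAl (K : fieldType) (A : algType K) (M : lmodType A) (x : K)
    (c : A) (v : M) : (x *: c) *: v = x *: (c *: v : res_scalars M).
Proof. by rewrite [RHS](scalerA (x%:A : A) c v) -scalerAl mul1r. Qed.

(** Multiplying by an element of B_1 replaces each coordinate by a combination of coordinates with
    coefficients in a fixed A_r, so every step in B costs at most r steps in A. *)
Lemma GK_le_corner (R : realType) (K : fieldType) (A B : algType K) n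
    (p : B -> 'M[A]_n) (M : lmodType A) (N : lmodType B)
    (f : N -> 'I_n -> M) :
  {morph p : b c / b + c} ->
  (forall (x : K) b k l, p (x *: b) k l = x *: p b k l) ->
  (forall u v, f u =1 f v -> u = v) ->
  (forall u v k, f (u + v) k = f u k + f v k) ->
  (forall b v, f (b *: v) =1 mxact p b (f v)) ->
  alg_fin_gen A -> alg_fin_gen B -> mod_fin_gen M -> mod_fin_gen N ->
  (GK N R <= GK M R)%E.
Proof.
move=> pD pZ finj fD fZ [a ga] [b gb].
move=> /mod_fin_gen_fin_dim[M0 gM] /mod_fin_gen_fin_dim[N0 gN].
rewrite (GKE R ga gM) (GKE R gb gN).
have fZA (x : K) c (v : N) k :
    f ((x *: c) *: v) k = (x%:A : A) *: f (c *: v) k.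
  rewrite !fZ /mxact scaler_sumr; apply: eq_bigr => l _.
  by rewrite pZ scalerA -scalerAl mul1r.
have fK (x : K) (v : res_scalars N) k :
    f (x *: v) k = x *: (f v k : res_scalars M).
  by have := fZA x 1 v k; rewrite scale1r.
have p0 k l : p 0 k l = 0 by rewrite -(scale0r (0 : B)) pZ scale0r.
have f0 k : f 0 k = 0.
  by rewrite -(scale0r (0 : N)) fZ /mxact big1// => l _; rewrite p0 scale0r.
have pre_submod i : is_submod (V := res_scalars N)
    [set v | forall k, mod_filt a M0 i (f v k)].
  have [W0 WD WZ] := mod_filt_submod a M0 i.
  split => /= [k|u v Wu Wv k|x v Wv k]; first by rewrite f0.
    by rewrite fD; exact: WD.
  by rewrite fK; exact: WZ.
have [m N0E] := gN.1.
have [q qm] := mod_filt_subset_fin m f ga gM.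
have qN0 v k : N0 v -> mod_filt a M0 q (f v k).
  move=> N0v; have : [set v | forall k, mod_filt a M0 q (f v k)] v by
    move: v N0v; rewrite N0E; apply: lspan_min (pre_submod q) _ => v mv k';
    exact: qm.
  exact.
(* As [p] need not be unital, the entries of [p 1] must be included with those of the generators. *)
pose P : seq A :=
  [seq p c kl.1 kl.2 | c <- 1 :: b, kl <- enum {: 'I_n * 'I_n}].
have [r rP] := directed_seq P (@alg_filt_mono K A a) (alg_filt_all ga).
have pB1 c k l : lspan ([set 1] `|` [set` b]) c -> alg_filt a r (p c k l).
  move: c; have [W0 WD WZ] := alg_filt_submod a r.
  apply: (@lspan_min K B _ [set c | alg_filt a r (p c k l)]).
    split => /= [|c d|x c]; first by rewrite p0.
      by rewrite pD mxE; exact: WD.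
    by rewrite pZ; exact: WZ.
  move=> c cb /=; apply: rP => /=.
  apply: (allpairs_f (fun c (kl : 'I_n * 'I_n) => p c kl.1 kl.2) (y := (k, l))).
    by case: cb => [->|cb]; rewrite inE ?eqxx// cb orbT.
  by rewrite mem_enum.
have act_submod i (v : N) :
    is_submod [set c : B | forall k, mod_filt a M0 i (f (c *: v) k)].
  have [W0 WD WZ] := pre_submod i.
  split => /= [k|c d Wc Wd|x c Wc]; first by rewrite scale0r; exact: W0.
    by rewrite scalerDl; exact: WD.
  by rewrite res_scalerAl; exact: WZ.
have key i (v : N) c k : alg_filt b i c -> N0 v ->
    mod_filt a M0 (r * i + q) (f (c *: v) k).
  move=> bc N0v; elim: i c bc k => [|i IH].
    rewrite muln0 add0n; apply: lspan_min (act_submod q v) _ => _ -> k.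
    by rewrite scale1r; exact: qN0.
  rewrite mulnS -addnA; apply: lspan_min (act_submod _ v) _.
  move=> _ [c [d [bc bd ->]]] k; rewrite -scalerA fZ.
  apply: (@submod_sum K (res_scalars M)); first exact: mod_filt_submod.
  by move=> l; apply: mod_filtM; [exact: pB1 | exact: IH].
apply: le_trans (le_growth_muln _ n).
(* [le_growth] takes a positive slope, so [r] is enlarged to [r.+1]. *)
apply: (@le_growth _ _ _ r q) => i.
apply: (@dimK_joint_inj _ _ (res_scalars N) (res_scalars M) _
  (fun k v => f v k)) => [k x u v|v fv|k v].
- by rewrite fD fK.
- by apply: finj => k; rewrite fv f0.
move: k; move: v.
suff : mod_filt b N0 i `<=`
    [set v | forall k, mod_filt a M0 (r.+1 * i + q) (f v k)].
  by move=> H v k /H.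
apply: mod_filt_min (pre_submod _) _ => c v bc N0v k.
apply: mod_filt_mono (key _ _ _ _ bc N0v).
by rewrite leq_add2r leq_mul2r leqnSn orbT.
Qed.

(** * Transfer of modules along a Morita context *)

Definition morita_context_sym (K : fieldType) (A B : algType K)
    (C : morita_context A B) : morita_context B A :=
  MoritaContext (@mulBYX K A B C) (@mulYAX K A B C) (@mulYXB K A B C)
    (@mulAXY K A B C) (@mulXBY K A B C) (@mulXYA K A B C) (@mulYXY K A B C)
    (@mulXYX K A B C).

Lemma morita_equivalent_sym (K : fieldType) (A B : algType K) :
  morita_equivalent A B -> morita_equivalent B A.
Proof. by move=> [C [CA CB]]; exists (morita_context_sym C). Qed.

(** Bilinearity absorbs the coefficients into the first factor. This yields the decompositions of
    1_A and 1_B. *)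
Lemma pairing_decomp (K : fieldType) (U V W : lmodType K)
    (g : {bilinear U -> V -> W}) w :
  lspan [set w | exists u v, w = g u v] w ->
  exists n (u : 'I_n -> U) (v : 'I_n -> V), w = \sum_i g (u i) (v i).
Proof.
move=> [n [c [z [gz ->]]]].
have [u /choice[v zE]] := choice gz.
exists n, (fun i => c i *: u i), v; apply: eq_bigr => i _.
by rewrite linearZl_LR zE.
Qed.

Section MoritaTransfer.
Variables (K : fieldType) (A B : algType K) (C : morita_context A B).
Local Notation XY := (mulXY (m := C)).
Local Notation YX := (mulYX (m := C)).
Variables (n : nat) (y : 'I_n -> ctxY C) (x : 'I_n -> ctxX C).
Hypothesis yx1 : 1 = \sum_k YX (y k) (x k).

(** The matrix of the action of b on Y in the coordinates v |-> (x_k v)_k. *)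
Definition ctx_mx (b : B) : 'M[A]_n :=
  \matrix_(k, l) XY (x k) (lact b (y l)).

(* Insert 1_B = sum_l y_l x_l in front of [v]. *)
Lemma mulXY_insert u b v :
  XY u (lact b v) = \sum_l XY u (lact b (y l)) * XY (x l) v.
Proof.
rewrite -[v in LHS]lact1 yx1 linear_sumlz !linear_sumr.
by apply: eq_bigr => l _; rewrite mulYXY -lractA mulXYA.
Qed.

Lemma ctx_mxD : {morph ctx_mx : b c / b + c}.
Proof. by move=> b c; apply/matrixP => k l; rewrite !mxE linearDl linearDr. Qed.

Lemma ctx_mxZ (t : K) b k l : ctx_mx (t *: b) k l = t *: ctx_mx b k l.
Proof. by rewrite !mxE linearZl_LR linearZr_LR. Qed.

Lemma ctx_mxM b c : ctx_mx (b * c) = ctx_mx b *m ctx_mx c.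
Proof.
apply/matrixP => k l; rewrite !mxE lactA mulXY_insert.
by apply: eq_bigr => j _; rewrite !mxE.
Qed.

Variable M : lmodType A.

(* The element v (x) m of Y (x)_A M, in the coordinates of the corner module. *)
Definition ctx_tensor (v : ctxY C) (m : M) (k : 'I_n) : M := XY (x k) v *: m.

Lemma mxact_ctx_tensor b v m :
  mxact ctx_mx b (ctx_tensor v m) =1 ctx_tensor (lact b v) m.
Proof.
move=> k; rewrite /ctx_tensor mulXY_insert scaler_suml.
by apply: eq_bigr => l _; rewrite mxE scalerA.
Qed.

Hypothesis XY1 : exists r (x' : 'I_r -> ctxX C) (y' : 'I_r -> ctxY C),
  1 = \sum_i XY (x' i) (y' i).

(** Here m = sum_i x'_i y'_i m, and inserting 1_B gives x'_i y'_i = sum_l (x'_i y_l)(x_l y'_i); so m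
    is an A-combination of the coordinates x_l y'_i m. *)
Lemma ctx_tensor_eq0 m : (forall v k, ctx_tensor v m k = 0) -> m = 0.
Proof.
have [r [x' [y' xy1]]] := XY1; move=> m0.
rewrite -[m]scale1r xy1 scaler_suml big1// => i _.
rewrite -(lact1 (y' i)) mulXY_insert scaler_suml big1// => l _.
by rewrite -scalerA [_ *: m]m0 scaler0.
Qed.

(** Since v = sum_i (v x'_i) y'_i, the [y' i] generate Y over B; hence the tensors of the [y' i]
    with generators of M generate N. *)
Lemma corner_fin_gen (N : lmodType B) (f : N -> 'I_n -> M) :
  (forall u v, f u =1 f v -> u = v) ->
  (forall u v k, f (u + v) k = f u k + f v k) ->
  (forall b v, f (b *: v) =1 mxact ctx_mx b (f v)) ->
  (forall m, mxact ctx_mx 1 m =1 m -> exists v, f v =1 m) ->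
  mod_fin_gen M -> mod_fin_gen N.
Proof.
move=> finj fD fZ fsurj [s sM].
have [r [x' [y' xy1]]] := XY1.
(* [t (v, m)] is the tensor v (x) m as an element of [N]; the identities below say that it is
   biadditive, A-balanced and B-linear. *)
have /choice[t tE] : forall vm : ctxY C * M, exists u,
    f u =1 ctx_tensor vm.1 vm.2.
  move=> [v m]; apply: fsurj => k.
  by rewrite mxact_ctx_tensor lact1.
have tD v m m' : t (v, m + m') = t (v, m) + t (v, m').
  by apply: finj => k; rewrite fD !tE /ctx_tensor scalerDr.
have tZ v a m : t (v, a *: m) = t (ract v a, m).
  by apply: finj => k; rewrite !tE /ctx_tensor scalerA mulXYA.
have tDl v v' m : t (v + v', m) = t (v, m) + t (v', m).
  by apply: finj => k; rewrite fD !tE /ctx_tensor linearDr scalerDl.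
have tl b v m : t (lact b v, m) = b *: t (v, m).
  apply: finj => k; rewrite fZ tE -mxact_ctx_tensor; apply: eq_mxact => l.
  by rewrite tE.
have t0 v : t (v, 0) = 0.
  by apply: (addIr (t (v, 0))); rewrite -tD !add0r.
have t0l m : t (0, m) = 0.
  by apply: (addIr (t (0, m))); rewrite -tDl !add0r.
pose G : seq N := [seq t (y' i, m) | i <- enum 'I_r, m <- s].
exists G; rewrite -subTset => u _.
have WG := lspan_submod (V := N) [set` G].
have Gm m : m \in s -> forall v, lspan (V := N) [set` G] (t (v, m)).
  move=> sm v; have -> : v = \sum_i lact (YX v (x' i)) (y' i).
    rewrite -[LHS]ract1 xy1 linear_sumr.
    by apply: eq_bigr => i _; rewrite mulYXY.
  have -> : t (\sum_i lact (YX v (x' i)) (y' i), m) =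
      \sum_i YX v (x' i) *: t (y' i, m).
    rewrite (big_morph (fun w => t (w, m)) (fun w w' => tDl w w' m) (t0l m)).
    by apply: eq_bigr => i _; rewrite tl.
  apply: submod_sum => // i; have [_ _ WZ] := WG; apply: WZ.
  apply: sub_lspan => /=; apply: (allpairs_f (fun i m => t (y' i, m))) => //.
  by rewrite mem_enum.
(* Quantifying over all [v] lets a scalar of A move from [m] to [v]. *)
have tG m : forall v, lspan (V := N) [set` G] (t (v, m)).
  have [W0 WD WZ] := WG.
  suff : [set: M] `<=` [set m | forall v, lspan (V := N) [set` G] (t (v, m))].
    exact.
  rewrite -sM; apply: lspan_min => //.
  split => /= [v|m1 m2 Wm1 Wm2 v|a m' Wm v].
  - by rewrite t0.
  - by rewrite tD; apply: WD.
  - by rewrite tZ.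
(* Coordinate k of 1 u = u is sum_l (x_k y_l) u_l, which is coordinate k of sum_l y_l (x) u_l. *)
have -> : u = \sum_l t (y l, f u l).
  apply: finj => k; rewrite -[u in LHS]scale1r fZ.
  have f0 : f 0 k = 0 by apply: (addIr (f 0 k)); rewrite -fD !add0r.
  rewrite (big_morph (f^~ k) (fun v w => fD v w k) f0).
  by apply: eq_bigr => l _; rewrite tE mxE lact1.
exact: submod_sum.
Qed.

End MoritaTransfer.

(** * Comparison of holonomic numbers *)

Lemma le_holonomic_number (R : realType) (K : fieldType) (A B : algType K) :
  alg_fin_gen A -> alg_fin_gen B -> morita_equivalent A B ->
  (holonomic_number R B <= holonomic_number R A)%E.
Proof.
move=> fA fB [C [CA CB]].
have := CA; rewrite -subTset => /(_ 1 I)/pairing_decomp XY1.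
have := CB; rewrite -subTset => /(_ 1 I)/pairing_decomp[n [y [x yx1]]].
apply: le_ereal_inf_tmp => _ [M [[m m0] fM ->]].
have [N [f [finj fD fZ fsurj]]] :=
  corner_module M (ctx_mxD y x) (ctx_mxM yx1).
have fN := corner_fin_gen yx1 XY1 finj fD fZ fsurj fM.
apply: (@le_trans _ _ (GK N R)).
  apply: ereal_inf_lbound; exists N; split => //.
  (* If [N] were zero, all tensors v (x) m would vanish, forcing m = 0. *)
  apply: contrapT => N0; move/eqP: m0; apply.
  apply: (ctx_tensor_eq0 yx1 XY1) => v k.
  have [k'|u fu] := fsurj (ctx_tensor x v m).
    by rewrite (mxact_ctx_tensor yx1) lact1.
  have f0 : f 0 k = 0 by apply: (addIr (f 0 k)); rewrite -fD !add0r.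
  rewrite -fu -f0; congr (f _ k); apply/eqP; apply: contrapT => /negP u0.
  by apply: N0; exists u.
exact: (GK_le_corner R (ctx_mxD y x) (ctx_mxZ y x) finj fD fZ).
Qed.

Theorem theorem1p6 (R : realType) (K : fieldType) (A B : algType K) :
  alg_fin_gen A -> alg_fin_gen B -> morita_equivalent A B ->
  holonomic_number R A = holonomic_number R B.
Proof.
move=> fA fB AB; apply/eqP; rewrite eq_le !le_holonomic_number//.
exact: morita_equivalent_sym.
Qed.
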